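(* Consider a finite game with player set $\mathcal{D}$, finite action sets $X_i$ ($i\in\mathcal{D}$), action space $X=\prod_{i\in\mathcal{D}}X_i$, and random utilities whose expectations $U_i:X\to\mathbb{R}$ make $\{\mathcal{D},\{X_i\},\{U_i\}\}$ an exact potential game with potential $\phi:X\to\mathbb{R}$ (utilities normalized by the maximum potential). Run the Binary Log-linear Learning Algorithm (BLLA), described in the context, with fixed temperature $\tau>0$ and $N$ estimation samples per utility estimate. Then the stochastically stable states of BLLA are the global maximizers of $\phi$ if one of the following holds: (1) the estimation noise is bounded in an interval of length $\ell$ and, for some $0<\xi<1$, the number of samples satisfies $$N\ \ge\ \Big(\log\big(\tfrac{4}{\xi}\big)+\tfrac{2}{\tau}\Big)\frac{\ell^2}{2(1-\xi)^2\tau^2};$$ (2) the estimation noise is unbounded with finite mean and variance, its moment generating function $M(\theta)$ is finite, $\theta^*=\arg\max_{\theta}\big(\theta(1-\xi)\tau-\log M(\theta)\big)$ for some $0<\xi<1$, and $$N\ \ge\ \frac{\log\big(\tfrac{4}{\xi}\big)+\tfrac{2}{\tau}}{\log\Big(\frac{e^{\theta^*(1-\xi)\tau}}{M(\theta^* )}\Big)}.$$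
   Context: A potential game: $U_i(a_i,a_{-i})-U_i(a_i',a_{-i})=\phi(a_i,a_{-i})-\phi(a_i',a_{-i})$ for all $i$, $a_i,a_i'\in X_i$, $a_{-i}\in X_{-i}$. Utilities are only observed through noisy samples: for a profile $a$ and player $i$, independent samples $\hat U_{i,k}(a)$, $k=1,\dots,N$, with $\mathbb{E}[\hat U_{i,k}(a)]=U_i(a)$, and the estimate is the sample mean $\hat U^N_i(a)=\frac1N\sum_{k=1}^N\hat U_{i,k}(a)$. The ''estimation noise'' is the per-sample error $\hat U_{i,k}(a)-\hat U_{i,k}(b)-(U_i(a)-U_i(b))$ of the estimated utility difference between two profiles $a,b$ that differ only in player $i$'s action. All utilities are normalized by the maximum value of the potential. BLLA: start from an arbitrary profile; at each step $t$, a player $i$ and a trial action $\hat a_i\in X_i$ are selected uniformly at random; the estimates $\hat U^N_i(a(t-1))$ and $\hat U^N_i(\hat a_i,a_{-i}(t-1))$ are computed from $N$ fresh samples each; with $\Delta^N_i=\hat U^N_i(a(t-1))-\hat U^N_i(\hat a_i,a_{-i}(t-1))$, player $i$ switches to $\hat a_i$ with probability $(1+e^{\Delta^N_i/\tau})^{-1}$ and otherwise keeps $a_i(t-1)$; all other players keep their actions. For fixed $\tau$ (and $N=N(\tau)$ chosen as in the claim) this defines an irreducible Markov chain on $X$ with stationary distribution $\pi^\tau$; a state $a$ is stochastically stable if $\lim_{\tau\to0^+}\pi^\tau(a)>0$. $\log$ is the natural logarithm. *)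

(* Defs.v *)
From HB Require Import structures.
From mathcomp Require Import all_boot all_order all_algebra.
From mathcomp Require Import all_classical all_reals all_analysis.
Import numFieldNormedType.Exports.
Import Order.TTheory GRing.Theory Num.Theory.

Set Implicit Arguments.
Unset Strict Implicit.
Unset Printing Implicit Defensive.

Local Open Scope classical_set_scope.
Local Open Scope ring_scope.

Definition profile (I : finType) (A : I -> finType) := {dffun forall i, A i}.

Definition upd (I : finType) (A : I -> finType) (a : profile A) (i : I) (x : A i)
  : profile A := [ffun j => @dfwith I A (fun k => a k) i x j].
Arguments upd {I A} a i x.

Definition exact_potential (R : realType) (I : finType) (A : I -> finType)
  (U : I -> profile A -> R) (phi : profile A -> R) : Prop :=
  forall (i : I) (a : profile A) (x : A i),
    U i a - U i (upd a i x) = phi a - phi (upd a i x).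

Definition normalized_potential (R : realType) (I : finType) (A : I -> finType)
  (phi : profile A -> R) : Prop :=
  (forall a, phi a <= 1) /\ (exists a, phi a = 1).

(** The utility samples of player i at profile a are drawn (independently)
    from the law [mu i a]; their expectation is U_i(a). *)
Definition sample_means (R : realType) (I : finType) (A : I -> finType)
  (mu : I -> profile A -> probability R R) (U : I -> profile A -> R) : Prop :=
  forall i a, (mu i a).-integrable setT EFin /\
              (\int[mu i a]_x (x%:E) = (U i a)%:E)%E.

(** Per-sample estimation noise of the utility difference between a and b
    (for player i), as a function of the pair of samples
    z = (hatU_{i,k}(a), hatU_{i,k}(b)), drawn from (mu i a) \x (mu i b):
    hatU(a) - hatU(b) - (U_i(a) - U_i(b)). *)
Definition noise (R : realType) (I : finType) (A : I -> finType)
  (U : I -> profile A -> R) (i : I) (a b : profile A) (z : R * R) : R :=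
  z.1 - z.2 - (U i a - U i b).

(** [two_sample_int m1 m2 n F s]: expectation of F(s + sum_{k<n} (X_k - Y_k))
    where X_1..X_n ~ m1 and Y_1..Y_n ~ m2 are all independent (written as
    iterated integrals over the independent pairs (X_k, Y_k) ~ m1 \x m2). *)
Fixpoint two_sample_int (R : realType) (m1 m2 : probability R R) (n : nat)
  (F : R -> R) (s : R) : R :=
  match n with
  | 0 => F s
  | n'.+1 => fine (\int[product_measure1 m1 m2]_z
                     (two_sample_int m1 m2 n' F (s + (z.1 - z.2)))%:E)%E
  end.

(** BLLA switching probability of player i at profile a towards trial action x,
    with temperature tau and N fresh samples for each of the two estimates:
    E[ (1 + exp(Delta^N / tau))^-1 ],
    Delta^N = hatU^N_i(a) - hatU^N_i(x, a_{-i}), where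
    hatU^N_i(.) = (1/N) sum_{k=1}^N hatU_{i,k}(.). *)
Definition switch_prob (R : realType) (I : finType) (A : I -> finType)
  (mu : I -> profile A -> probability R R) (tau : R) (N : nat)
  (i : I) (a : profile A) (x : A i) : R :=
  two_sample_int (mu i a) (mu i (upd a i x)) N
    (fun s => (1 + expR ((s / N%:R) / tau))^-1) 0.
Arguments switch_prob {R I A} mu tau N i a x.

Definition blla_trans (R : realType) (I : finType) (A : I -> finType)
  (mu : I -> profile A -> probability R R) (tau : R) (N : nat)
  (a b : profile A) : R :=
  \sum_(i : I) \sum_(x : A i)
     ((#|I|%:R)^-1 * (#|A i|%:R)^-1) *
     (switch_prob mu tau N i a x * (b == upd a i x)%:R
      + (1 - switch_prob mu tau N i a x) * (b == a)%:R).

Definition stationary (R : realType) (T : finType) (P : T -> T -> R)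
  (pi : T -> R) : Prop :=
  (forall b, 0 <= pi b) /\ (\sum_b pi b = 1) /\
  (forall b, pi b = \sum_a pi a * P a b).

Definition stochastically_stable (R : realType) (T : finType)
  (pi : R -> T -> R) (a : T) : Prop :=
  exists L : R, 0 < L /\ (pi tau a @[tau --> 0^'+] --> L).

Definition cond_bounded (R : realType) (I : finType) (A : I -> finType)
  (mu : I -> profile A -> probability R R) (U : I -> profile A -> R)
  (N : R -> nat) (xi : R) : Prop :=
  exists ell : R, 0 <= ell /\
    (forall (i : I) (a : profile A) (x : A i), x != a i ->
       exists c : R, {ae product_measure1 (mu i a) (mu i (upd a i x)), forall z,
          c <= noise U i a (upd a i x) z <= c + ell}) /\
    (forall tau : R, 0 < tau ->
       (ln (4 / xi) + 2 / tau) * ell ^+ 2 / (2 * (1 - xi) ^+ 2 * tau ^+ 2)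
         <= (N tau)%:R).

Definition noise_mgf (R : realType) (I : finType) (A : I -> finType)
  (mu : I -> profile A -> probability R R) (U : I -> profile A -> R)
  (i : I) (a b : profile A) (theta : R) : \bar R :=
  (\int[product_measure1 (mu i a) (mu i b)]_z (expR (theta * noise U i a b z))%:E)%E.

Definition cond_unbounded (R : realType) (I : finType) (A : I -> finType)
  (mu : I -> profile A -> probability R R) (U : I -> profile A -> R)
  (N : R -> nat) (xi : R) : Prop :=
  forall (i : I) (a : profile A) (x : A i), x != a i ->
    let b := upd a i x in
    let m := product_measure1 (mu i a) (mu i b) in
    let M := fun theta => fine (noise_mgf mu U i a b theta) in
    [/\ m.-integrable setT (fun z => (noise U i a b z)%:E),
        (\int[m]_z ((noise U i a b z) ^+ 2)%:E < +oo)%E,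
        ~ (exists B : R, {ae m, forall z, `|noise U i a b z| <= B}),
        (forall theta : R, (noise_mgf mu U i a b theta < +oo)%E) &
        (forall tau : R, 0 < tau ->
           exists theta_star : R,
             (forall theta : R,
                theta * (1 - xi) * tau - ln (M theta)
                  <= theta_star * (1 - xi) * tau - ln (M theta_star)) /\
             (ln (4 / xi) + 2 / tau)
               / ln (expR (theta_star * (1 - xi) * tau) / M theta_star)
               <= (N tau)%:R)].

(* Main.v *)
(* The sampled switching probability is within a factor [1 + o(1)] of the
   noiseless logistic one as the temperature vanishes. Indeed both conditions on
   [N] force [N tau^2 -> oo]; as the noise is centred with finite moment
   generating function [M], [log M(t) = O(t^2)], so the averaged noise W satisfies
   [E e^(W / tau), E e^(- W / tau) <= e^(O(1 / (N tau^2))) -> 1], and these two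
   moments control the expected logistic function. This is much more precise than
   a tail bound on W, and it needs no bound on the range of the potential.

   The noiseless chain is reversible for the Gibbs law [g(a) ~ e^(phi a / tau)], so
   the noisy one satisfies [g a * P a b <= rho * (g b * P b a)] with [rho -> 1].
   The stationary flow across every cut vanishes, so for [h = p / g] no level set
   of [h] can be separated from the rest by a ratio above [rho]; hence [h] varies
   by at most a factor [rho ^ #|X|] over the whole state space, and the stationary
   law has the same limit as the Gibbs law. *)

Require Import Defs.
From HB Require Import structures.
From mathcomp Require Import all_boot all_order all_algebra.
From mathcomp Require Import all_classical all_reals all_analysis.
From mathcomp Require Import measurable_realfun ring lra.
Import numFieldNormedType.Exports.
Import Order.TTheory GRing.Theory Num.Theory.
Local Open Scope classical_set_scope.
Local Open Scope ring_scope.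

Set Implicit Arguments.
Unset Strict Implicit.
Unset Printing Implicit Defensive.

(** * Stationary laws of nearly reversible chains *)

(** The mass of [S] splits by destination, as rows sum to 1, and by origin, by stationarity; the
    flow inside [S] is common to both and cancels. *)
Lemma stationary_cut (R : realType) (T : finType) (P : T -> T -> R)
    (p : T -> R) (S : {set T}) :
  (forall a, \sum_b P a b = 1) -> stationary P p ->
  \sum_(a in S) \sum_(b in ~: S) p a * P a b =
  \sum_(a in S) \sum_(b in ~: S) p b * P b a.
Proof.
move=> P1 [_ [_ pP]].
have splitS (f : T -> R) :
    \sum_b f b = \sum_(b in S) f b + \sum_(b in ~: S) f b.
  rewrite (bigID (mem S)) /=; congr (_ + _).
  by apply: eq_bigl => b; rewrite inE.
have out : \sum_(a in S) p a = \sum_(a in S) \sum_(b in S) p a * P a b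
    + \sum_(a in S) \sum_(b in ~: S) p a * P a b.
  rewrite -big_split /=; apply: eq_bigr => a _.
  by rewrite -splitS -mulr_sumr P1 mulr1.
have inn : \sum_(a in S) p a = \sum_(a in S) \sum_(b in S) p b * P b a
    + \sum_(a in S) \sum_(b in ~: S) p b * P b a.
  by rewrite -big_split /=; apply: eq_bigr => a _; rewrite -splitS -pP.
by apply: (addrI (\sum_(a in S) \sum_(b in S) p a * P a b));
  rewrite -out inn exchange_big.
Qed.

(** Otherwise [p / g] on [S] exceeds [rho] times each value outside, and near reversibility makes
    the flow along every pair leaving [S] at least the return flow, strictly from [a0] to [b0]. This
    contradicts the balance across the cut. *)
Lemma stationary_cut_compare (R : realType) (T : finType) (P : T -> T -> R)
    (p g : T -> R) (rho : R) (S : {set T}) (a0 b0 : T) :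
  (forall a, \sum_b P a b = 1) -> stationary P p ->
  (forall a, 0 < g a) -> (forall a b, a != b -> 0 <= P a b) ->
  (forall a b, a != b -> g a * P a b <= rho * (g b * P b a)) ->
  a0 \in S -> b0 \notin S -> 0 < P a0 b0 ->
  exists a b, [/\ a \in S, b \notin S & p a / g a <= rho * (p b / g b)].
Proof.
move=> P1 st g0 P0 rev aS bS ab0; apply: contrapT => nex.
have gt a b : a \in S -> b \notin S -> rho * (p b / g b) < p a / g a.
  by move=> ? ?; rewrite ltNge; apply/negP => le; apply: nex; exists a, b.
have neq a b : a \in S -> b \notin S -> b != a.
  by move=> aS' bS'; apply: contraNneq bS' => ->.
have flow a b : a \in S -> b \notin S -> p b * P b a <= p a * P a b ?= iff
    (P a b == 0).
  move=> aS' bS'.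
  have ba := neq _ _ aS' bS'; have ab : a != b by rewrite eq_sym.
  have p0 : 0 <= p b / g b by rewrite divr_ge0 ?(ltW (g0 _)) ?st.1.
  (* Flows are written as [p / g] times Gibbs flows, to which [rev] applies. *)
  have eqf c d : p c * P c d = p c / g c * (g c * P c d).
    by rewrite mulrA divfK // gt_eqF.
  rewrite [p b * _]eqf [p a * _]eqf.
  have le1 : p b / g b * (g b * P b a) <= p b / g b * (rho * (g a * P a b)).
    by rewrite ler_wpM2l // rev.
  have [Pab|Pab] := eqVneq (P a b) 0.
    rewrite Pab !mulr0 in le1 *; split=> //; apply/eqP/le_anti.
    by rewrite le1 mulr_ge0 // mulr_ge0 ?P0 // ltW.
  suff lt : p b / g b * (g b * P b a) < p a / g a * (g a * P a b).
    by split; [exact: ltW | rewrite lt_eqF].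
  apply: le_lt_trans le1 _.
  have Pab0 : 0 < P a b by rewrite lt_neqAle eq_sym Pab P0.
  by rewrite mulrCA mulrA ltr_pM2r ?gt // mulr_gt0.
have := stationary_cut S P1 st => /esym/eqP; apply/negP; rewrite lt_eqF //.
rewrite (bigD1 a0) //= [ltRHS](bigD1 a0) //= ltr_leD //; last first.
  apply: ler_sum => a /andP[aS' _]; apply: ler_sum => b; rewrite inE => bS'.
  exact: (flow a b aS' bS').1.
rewrite (bigD1 b0) ?inE //= [ltRHS](bigD1 b0) ?inE //= ltr_leD //; last first.
  apply: ler_sum => b; rewrite inE => /andP[bS' _].
  exact: (flow a0 b aS bS').1.
by rewrite (lt_leif (flow a0 b0 aS bS)) gt_eqF.
Qed.

(* With h = p / g, the sets {h <= rho ^ k * h b} grow strictly with k until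
   they exhaust the state space. *)
Lemma stationary_compare (R : realType) (T : finType) (P : T -> T -> R)
    (p g : T -> R) (rho : R) :
  1 <= rho -> (forall a, \sum_b P a b = 1) -> stationary P p ->
  (forall a, 0 < g a) -> (forall a b, a != b -> 0 <= P a b) ->
  (forall a b, a != b -> g a * P a b <= rho * (g b * P b a)) ->
  (forall (S : {set T}) a b, a \in S -> b \notin S ->
     exists a' b', [/\ a' \in S, b' \notin S & 0 < P a' b']) ->
  forall a b, p a / g a <= rho ^+ #|T| * (p b / g b).
Proof.
move=> rho1 P1 st g0 P0 rev conn a b.
have rho0 : 0 <= rho := le_trans ler01 rho1.
have h0 c : 0 <= p c / g c by rewrite divr_ge0 ?(ltW (g0 _)) ?st.1.
pose V k := [set c | p c / g c <= rho ^+ k * (p b / g b)]%SET.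
have bV k : b \in V k by rewrite inE ler_peMl ?exprn_ege1.
(* Each level gains a state or is already everything, so level [#|T|] is the whole space. *)
suff /(_ #|T|) : forall k, (minn k.+1 #|T| <= #|V k|)%N.
  rewrite (minn_idPr (leqnSn _)) => leV.
  have /eqP VT : V #|T| == [set: T]%SET.
    by rewrite eqEcard finset.subsetT cardsT.
  by have := finset.in_setT a; rewrite -VT inE.
elim=> [|k IH].
  by rewrite geq_min; apply/orP; left; apply/card_gt0P; exists b.
have subV : V k \subset V k.+1.
  apply/fintype.subsetP => c; rewrite !inE exprS -mulrA => /le_trans; apply.
  by rewrite ler_peMl // mulr_ge0 ?h0 ?exprn_ge0.
have [/existsP[c cV]|nV] := boolP [exists c, c \notin V k]; last first.
  have VT : V k = [set: T]%SET.
    apply/setP => c; rewrite !inE; move/existsPn: nV => /(_ c).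
    by rewrite negbK inE.
  have /subset_leq_card := subV; rewrite VT cardsT => leT.
  by rewrite geq_min leT orbT.
(* The cut is taken around the complement: some [d] outside level [k] has [p / g] at most [rho]
   times its value at some [e] in level [k], so [d] enters level [k.+1]. *)
have [||a' [b' [a'V b'V P']]] := conn (~: V k)%SET c b; first by rewrite inE.
  by rewrite inE negbK.
have [d [e [dV eV de]]] := stationary_cut_compare P1 st g0 P0 rev a'V b'V P'.
have : (#|V k| < #|V k.+1|)%N.
  apply/proper_card/properP; split=> //; exists d; last by rewrite inE in dV.
  rewrite inE negbK inE in eV; rewrite inE exprS -mulrA.
  by apply: le_trans de _; rewrite ler_wpM2l.
move=> ltV; move: IH; rewrite !geq_min => /orP[le1|le2].
  by rewrite (leq_ltn_trans le1 ltV).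
by rewrite (leq_trans le2 (ltnW ltV)) orbT.
Qed.

(** * The learning chain and the Gibbs law *)

Lemma upd_coord (I : finType) (A : I -> finType) (a b : profile A) (i : I)
    (x : A i) :
  b = upd a i x -> x = b i.
Proof. by move=> ->; rewrite ffunE dfwithin. Qed.

Lemma upd_swap (I : finType) (A : I -> finType) (a b : profile A) (i : I) :
  b = upd a i (b i) -> a = upd b i (a i).
Proof.
move=> ba; apply/ffunP => j; rewrite ffunE.
case: dfwithP => // k ik.
by rewrite ba ffunE dfwithout.
Qed.

(** Replacing the coordinates of [a] by those of [b] one player at a time must leave [S] at some
    step. This yields the connectivity of the chain. *)
Lemma upd_leaves (I : finType) (A : I -> finType) (S : {set profile A})
    (a b : profile A) :
  a \in S -> b \notin S ->
  exists c i (x : A i), c \in S /\ upd c i x \notin S.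
Proof.
move=> aS bS; apply: contrapT => nex.
have stay c i (x : A i) : c \in S -> upd c i x \in S.
  by move=> cS; apply: contrapT => /negP xS; apply: nex; exists c, i, x.
pose m s := foldr (fun i c => upd c i (b i)) a s.
have mS s : m s \in S by elim: s => //= i s IH; exact: stay.
have mE s j : m s j = if j \in s then b j else a j.
  elim: s j => //= i s IH j; rewrite ffunE in_cons.
  case: dfwithP => [|k ik]; first by rewrite eqxx.
  by rewrite eq_sym (negbTE ik) IH.
have mb : m (enum I) = b by apply/ffunP => j; rewrite mE mem_enum.
by move: bS; rewrite -mb mS.
Qed.

Section BLLAChain.
Variables (R : realType) (I : finType) (A : I -> finType).
Variables (mu : I -> profile A -> probability R R) (tau : R) (N : nat).
Local Notation P := (blla_trans mu tau N).
Local Notation sp := (switch_prob mu tau N).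

Let w (i : I) : R := (#|I|%:R)^-1 * (#|A i|%:R)^-1.

(** The term for keeping the action vanishes, and [b i] is the only trial action of player [i] that
    can lead to [b]. *)
Lemma blla_trans_offdiag (a b : profile A) : a != b ->
  P a b = \sum_(i : I) w i * (sp i a (b i) * (b == upd a i (b i))%:R).
Proof.
move=> ab; apply: eq_bigr => i _.
rewrite (bigD1 (b i)) //= [b == a]eq_sym (negbTE ab) mulr0 addr0.
rewrite [X in _ + X]big1 ?addr0 // => x xb.
case: eqP => [/upd_coord xE|_]; first by rewrite xE eqxx in xb.
by rewrite !mulr0 addr0 mulr0.
Qed.

Lemma blla_trans_sum1 (a : profile A) : (0 < #|I|)%N -> \sum_b P a b = 1.
Proof.
move=> I0; rewrite exchange_big /=.
under eq_bigr => i _.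
  rewrite exchange_big /=.
  under eq_bigr => x _.
    rewrite -mulr_sumr big_split /= -!mulr_sumr.
    have one (c : profile A) : \sum_b (b == c)%:R = 1 :> R.
      rewrite (bigD1 c) //= eqxx big1 ?addr0 // => b /negbTE -> //.
    rewrite !one !mulr1 addrC subrK mulr1.
    over.
  rewrite sumr_const -[(_ * _) *+ _]mulr_natr divfK; last first.
    by rewrite pnatr_eq0 -lt0n; apply/card_gt0P; exists (a i).
  over.
by rewrite sumr_const -[_^-1 *+ _]mulr_natr mulVf // pnatr_eq0 -lt0n.
Qed.

Variables (phi : profile A -> R) (r : R).
Hypotheses (r1 : 1 <= r).
Hypothesis sp_close : forall i (a : profile A) (x : A i), x != a i ->
  sp i a x <= r * (1 + expR ((phi a - phi (upd a i x)) / tau))^-1 /\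
  (1 + expR ((phi a - phi (upd a i x)) / tau))^-1 <= r * sp i a x.
Local Notation g := (fun a => expR (phi a / tau)).

Lemma switch_prob_gt0 i (a : profile A) (x : A i) : x != a i -> 0 < sp i a x.
Proof.
move=> /sp_close[_ le]; rewrite -(pmulr_rgt0 _ (lt_le_trans ltr01 r1)).
by apply: lt_le_trans le; rewrite invr_gt0 addr_gt0 // expR_gt0.
Qed.

(** Detailed balance of the noiseless chain: both sides equal [g a * g b / (g a + g b)]. *)
Lemma gibbs_switch (a b : profile A) :
  g a * (1 + expR ((phi a - phi b) / tau))^-1 =
  g b * (1 + expR ((phi b - phi a) / tau))^-1.
Proof.
rewrite !mulrBl !expRD !expRN.
have ga := expR_gt0 (phi a / tau); have gb := expR_gt0 (phi b / tau).
field; rewrite !gt_eqF //=; exact: addr_gt0.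
Qed.

Lemma upd_diag (a b : profile A) i : a != b -> b = upd a i (b i) -> b i != a i.
Proof.
move=> ab ba; apply: contraNneq ab => bi; apply/eqP/ffunP => j.
rewrite ba ffunE; case: dfwithP => //.
Qed.

(** One factor [r] replaces the noisy switching probability by the logistic one; after detailed
    balance, a second one returns to the noisy probability of the reverse move. *)
Lemma blla_reversible_approx (a b : profile A) : a != b ->
  g a * P a b <= r ^+ 2 * (g b * P b a).
Proof.
move=> ab; have ba : b != a by rewrite eq_sym.
rewrite !blla_trans_offdiag // !mulr_sumr; apply: ler_sum => i _.
have [bE|bN] := eqVneq b (upd a i (b i)); last first.
  have [aE|aN] := eqVneq a (upd b i (a i)); last by rewrite !mulr0.
  by rewrite -(upd_swap aE) eqxx in bN.
have aE := upd_swap bE; rewrite -aE eqxx !mulr1.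
have [up _] := sp_close (upd_diag ab bE).
have [_ lo] := sp_close (upd_diag ba aE).
rewrite -bE in up; rewrite -aE in lo.
have w0 : 0 <= w i by rewrite mulr_ge0 // invr_ge0.
have r0 : 0 <= r := le_trans ler01 r1.
rewrite mulrCA [leRHS](_ : _ = w i * (r * (g b * (r * sp i b (a i)))));
  last by ring.
rewrite ler_wpM2l //; apply: (@le_trans _ _
  (g a * (r * (1 + expR ((phi a - phi b) / tau))^-1))).
  by rewrite ler_wpM2l // expR_ge0.
by rewrite mulrCA gibbs_switch !ler_wpM2l // expR_ge0.
Qed.

Lemma blla_trans_ge0 (a b : profile A) : a != b -> 0 <= P a b.
Proof.
move=> ab; rewrite blla_trans_offdiag //; apply: sumr_ge0 => i _.
apply: mulr_ge0; first by rewrite mulr_ge0 ?invr_ge0.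
case: (b =P upd a i (b i)) => [bE|]; last by rewrite mulr0.
by rewrite mulr1 ltW // switch_prob_gt0 // (upd_diag ab).
Qed.

Lemma blla_trans_upd_gt0 (a : profile A) i (x : A i) :
  a != upd a i x -> 0 < P a (upd a i x).
Proof.
move=> ab; rewrite blla_trans_offdiag // (bigD1 i) //=.
have xE : upd a i x i = x by rewrite ffunE dfwithin.
rewrite ltr_pwDl //.
  rewrite xE eqxx mulr1 !mulr_gt0 ?invr_gt0 ?ltr0n //.
  - by apply/card_gt0P; exists i.
  - by apply/card_gt0P; exists x.
  - apply: switch_prob_gt0; rewrite -[X in X != _]xE.
    by apply: upd_diag => //; rewrite xE.
apply: sumr_ge0 => j _; apply: mulr_ge0; first by rewrite mulr_ge0 ?invr_ge0.
case: (upd a i x =P upd a j (upd a i x j)) => [bE|]; last by rewrite mulr0.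
by rewrite mulr1 ltW // switch_prob_gt0 // (upd_diag ab).
Qed.

Lemma blla_near_gibbs (p : profile A -> R) : stationary P p ->
  let n := #|{: profile A}| in let Z := \sum_b g b in
  forall a, g a / Z <= (r ^+ 2) ^+ n * p a /\ p a <= (r ^+ 2) ^+ n * (g a / Z).
Proof.
move=> st n Z a.
(* Without players every transition weight is an empty sum, and stationarity would force total mass
   0. *)
have I0 : (0 < #|I|)%N.
  rewrite lt0n; apply/negP => /eqP I0; case: st => _ [+ pE].
  suff -> : \sum_b p b = 0 by move/esym/eqP; rewrite oner_eq0.
  apply: big1 => b _; rewrite pE; apply: big1 => c _.
  rewrite /blla_trans big1 ?mulr0 // => i _.
  by have := card0_eq I0 i; rewrite !inE.
have r1' : 1 <= r ^+ 2 by rewrite exprn_ege1.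
have g0 b : 0 < g b by exact: expR_gt0.
have rows c : \sum_d P c d = 1 by exact: blla_trans_sum1.
have cmp b c : p b / g b <= (r ^+ 2) ^+ n * (p c / g c).
  apply: (stationary_compare r1' rows st g0).
  - exact: blla_trans_ge0.
  - exact: blla_reversible_approx.
  move=> S d e dS eS; have [c' [i [x [c'S xS]]]] := upd_leaves dS eS.
  exists c', (upd c' i x); split=> //; apply: blla_trans_upd_gt0.
  by apply: contraNneq xS => <-.
(* Cross-multiplied, so that summing over one state brings in the normalizations of [p] and [g]. *)
have cmpM b c : p b * g c <= (r ^+ 2) ^+ n * (g b * p c).
  have := cmp b c; rewrite ler_pdivrMr // mulrA -[_ / _ * _]mulrAC.
  by rewrite ler_pdivlMr // -mulrA [p c * _]mulrC.
have Z0 : 0 < Z.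
  rewrite /Z (bigD1 a) //= ltr_pwDl // sumr_ge0 // => b _; exact: ltW.
split.
  rewrite ler_pdivrMr // -mulrA.
  have := ler_sum (index_enum _) (fun b (_ : xpredT b) => cmpM b a).
  by rewrite -mulr_suml st.2.1 mul1r -mulr_sumr -mulr_suml [Z * _]mulrC.
rewrite mulrA ler_pdivlMr //.
have := ler_sum (index_enum _) (fun b (_ : xpredT b) => cmpM a b).
by rewrite -!mulr_sumr st.2.1 mulr1.
Qed.

End BLLAChain.

(** * Low-temperature limits of the Gibbs and stationary laws *)

Lemma cvg_expR_div0 (R : realType) (c : R) : c < 0 ->
  expR (c / t) @[t --> 0^'+] --> 0.
Proof.
move=> c0; have nc0 : 0 < - c by rewrite oppr_gt0.
(* The upper bound comes from [u <= expR u] at [u = - c / t]. *)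
apply: (@squeeze_cvgr _ _ _ _ (cst 0) (fun t : R => (- c)^-1 * t)).
- near=> t; have t0 : 0 < t by near: t; exact: nbhs_right_gt.
  have -> : expR (c / t) = (expR (- c / t))^-1 by rewrite -expRN mulNr opprK.
  have -> : (- c)^-1 * t = (- c / t)^-1 by rewrite invfM invrK.
  rewrite /cst invr_ge0 expR_ge0 /= lef_pV2 ?posrE ?expR_gt0 ?divr_gt0 //.
  by apply: le_trans (expR_ge1Dx _); rewrite lerDr.
- exact: cvg_cst.
- rewrite -[X in _ --> X](mulr0 (- c)^-1); apply: cvgMl_tmp.
  exact: cvg_at_right_filter.
Unshelve. all: by end_near. Qed.

Lemma gibbs_weightE (R : realType) (T : finType) (phi : T -> R) (a : T) (t : R) :
  expR (phi a / t) / (\sum_b expR (phi b / t)) =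
  (\sum_b expR ((phi b - phi a) / t))^-1.
Proof.
under [in RHS]eq_bigr => b _ do rewrite mulrBl expRD expRN.
by rewrite -mulr_suml invfM invrK mulrC.
Qed.

(** Relative to the weight of [a], each term of the denominator tends to 1 at a maximizer and to 0
    elsewhere; the limit is the inverse of the number of maximizers. *)
Lemma gibbs_cvg_max (R : realType) (T : finType) (phi : T -> R) (a : T) :
  (forall b, phi b <= phi a) -> exists L : R, 0 < L /\
  expR (phi a / t) / (\sum_b expR (phi b / t)) @[t --> 0^'+] --> L.
Proof.
move=> amax; pose M := \sum_b (phi b == phi a)%:R : R.
have M0 : 0 < M.
  by rewrite /M (bigD1 a) //= eqxx ltr_pwDl // sumr_ge0.
exists M^-1; split; first by rewrite invr_gt0.
under eq_cvg do rewrite gibbs_weightE.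
apply: cvgV; first by rewrite gt_eqF.
apply: cvg_big => [|b _]; first exact: add_continuous.
have [->|neq] := eqVneq (phi b) (phi a).
  under eq_cvg do rewrite subrr mul0r expR0.
  exact: cvg_cst.
by apply: cvg_expR_div0; rewrite subr_lt0 lt_neqAle neq amax.
Qed.

(** Keeping only the term of [b] in the denominator bounds the weight by
    [expR ((phi a - phi b) / t)], which vanishes. *)
Lemma gibbs_cvg_nonmax (R : realType) (T : finType) (phi : T -> R) (a b : T) :
  phi a < phi b ->
  expR (phi a / t) / (\sum_c expR (phi c / t)) @[t --> 0^'+] --> (0 : R).
Proof.
move=> ab.
apply: (@squeeze_cvgr _ _ _ _ (cst 0) (fun t : R => expR ((phi a - phi b) / t))).
- near=> t; rewrite gibbs_weightE.
  have S0 : 0 <= \sum_(c | c != b) expR ((phi c - phi a) / t).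
    by apply: sumr_ge0 => c _; exact: expR_ge0.
  rewrite (bigD1 b) //= invr_ge0 addr_ge0 ?expR_ge0 //=.
  have -> : expR ((phi a - phi b) / t) = (expR ((phi b - phi a) / t))^-1.
    by rewrite -expRN -mulNr opprB.
  rewrite lef_pV2 ?posrE ?expR_gt0 ?ltr_pwDl ?expR_gt0 //.
  by rewrite lerDl.
- exact: cvg_cst.
- by apply: cvg_expR_div0; rewrite subr_lt0.
Unshelve. all: by end_near. Qed.

(** As [g] stays in [0, 1], a vanishing relative error is also a vanishing absolute error. *)
Lemma cvg_of_ratio (R : realType) (f g : R -> R) (L : R) :
  (forall t, 0 <= g t <= 1) ->
  (forall d : R, 0 < d -> \forall t \near 0^'+,
     g t <= expR d * f t /\ f t <= expR d * g t) ->
  g t @[t --> 0^'+] --> L -> f t @[t --> 0^'+] --> L.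
Proof.
move=> g01 fg gL; rewrite -[L]add0r.
have -> : f = (f \- g) \+ g by apply/funext => t /=; rewrite subrK.
apply: cvgD => //; apply/cvgrPdist_le => /= e; move: (e : R) => {}e e0.
have e1 : 1 < 1 + e by rewrite ltrDl.
near=> t; rewrite sub0r normrN ler_norml /=.
have [lo up] : g t <= (1 + e) * f t /\ f t <= (1 + e) * g t.
  near: t; have := fg _ (ln_gt0 e1).
  by rewrite lnK ?posrE ?addr_gt0.
have /andP[g0 g1] := g01 t.
have f0 : 0 <= f t.
  by rewrite -(pmulr_rge0 _ (addr_gt0 ltr01 e0)); exact: le_trans lo.
have eg : e * g t <= e by rewrite ler_piMr // ltW.
apply/andP; split; last by nra.
by rewrite -(ler_pM2l (addr_gt0 ltr01 e0)); nra.
Unshelve. all: by end_near. Qed.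

Lemma stable_iff_max (R : realType) (I : finType) (A : I -> finType)
    (mu : I -> profile A -> probability R R) (phi : profile A -> R)
    (N : R -> nat) (pi : R -> profile A -> R) :
  (forall tau : R, 0 < tau ->
     stationary (blla_trans mu tau (N tau)) (pi tau)) ->
  (forall d : R, 0 < d -> \forall tau \near 0^'+,
     forall i (a : profile A) (x : A i), x != a i ->
       let s := (1 + expR ((phi a - phi (upd a i x)) / tau))^-1 in
       let sp := switch_prob mu tau (N tau) i a x in
       sp <= expR d * s /\ s <= expR d * sp) ->
  forall a : profile A,
    stochastically_stable pi a <-> (forall b : profile A, phi b <= phi a).
Proof.
move=> st close a.
pose G t := expR (phi a / t) / (\sum_b expR (phi b / t)).
have T0 : (0 < #|{: profile A}|)%N by apply/card_gt0P; exists a.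
have transfer (L : R) : G t @[t --> 0^'+] --> L -> pi t a @[t --> 0^'+] --> L.
  move=> GL; apply: (@cvg_of_ratio _ (fun t => pi t a) G _ _ _ GL) => [t|d d0].
    have Z0 : 0 <= \sum_(b | b != a) expR (phi b / t).
      by apply: sumr_ge0 => c _; exact: expR_ge0.
    rewrite /G (bigD1 a) //= divr_ge0 ?addr_ge0 ?expR_ge0 //=.
    by rewrite ler_pdivrMr ?mul1r ?lerDl // ltr_pwDl ?expR_gt0.
  (* Comparison with the Gibbs law costs [r ^+ 2] once per profile, that is [r ^+ k];
     [r = expR (d / k%:R)] turns this into [expR d]. *)
  pose k : nat := (2 * #|{: profile A}|)%N.
  have k0 : 0 < k%:R :> R by rewrite ltr0n muln_gt0.
  near=> t.
  have t0 : 0 < t by near: t; exact: nbhs_right_gt.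
  have r1 : 1 <= expR (d / k%:R).
    by rewrite -expR0 ler_expR divr_ge0 // ltW.
  have cl : forall i (b : profile A) (x : A i), x != b i ->
      let s := (1 + expR ((phi b - phi (upd b i x)) / t))^-1 in
      let sp := switch_prob mu t (N t) i b x in
      sp <= expR (d / k%:R) * s /\ s <= expR (d / k%:R) * sp.
    by near: t; apply: close; exact: divr_gt0.
  have := blla_near_gibbs r1 cl (st _ t0) a.
  by rewrite /= -exprM -/k -expRM_natl mulrCA divff ?gt_eqF // mulr1.
split=> [[L [L0 piL]] b|amax].
  rewrite leNgt; apply/negP => ab.
  have := transfer _ (gibbs_cvg_nonmax ab).
  move/(cvg_unique (@norm_hausdorff _ _) piL) => L00.
  by rewrite L00 ltxx in L0.
have [L [L0 GL]] := gibbs_cvg_max amax.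
by exists L; split=> //; exact: transfer.
Unshelve. all: by end_near. Qed.

(** * Moment generating functions *)

Section RealIntegrable.
Context d (T : measurableType d) (R : realType) (P : {measure set T -> \bar R}).
Implicit Types f g : T -> R.

Lemma integrable_addR f g : P.-integrable setT (EFin \o f) ->
  P.-integrable setT (EFin \o g) ->
  P.-integrable setT (EFin \o (fun x => f x + g x)).
Proof. by move=> fi gi; apply: integrableD (fi) (gi). Qed.

Lemma integrable_scaleR (c : R) f : P.-integrable setT (EFin \o f) ->
  P.-integrable setT (EFin \o (fun x => c * f x)).
Proof. by move=> fi; apply: integrableZl (fi). Qed.

Lemma integrable_ge0_lty f : measurable_fun setT f -> (forall x, 0 <= f x) ->
  (\int[P]_x (f x)%:E < +oo)%E -> P.-integrable setT (EFin \o f).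
Proof.
move=> mf f0 fy; apply/integrableP; split; first exact/measurable_EFinP.
by under eq_integral => x _ do rewrite /= ger0_norm //.
Qed.

End RealIntegrable.

(** * Elementary inequalities for the exponential *)

Section ExpInequalities.
Variable R : realType.
Implicit Types u w t : R.

Lemma expR_sub1_le u : expR u - 1 <= u * expR u.
Proof.
have := expR_ge1Dx (- u); rewrite expRN => le.
have e0 := expR_gt0 u.
have := ler_wpM2r (ltW e0) le; rewrite mulVf ?gt_eqF //; lra.
Qed.

(** Second-order Taylor bound; the symmetric remainder covers both signs of [u]. *)
Lemma expR_le_taylor1 u : expR u <= 1 + u + u ^+ 2 * (expR u + expR (- u)).
Proof.
have e0 := expR_gt0 u; have e1 := expR_gt0 (- u).
have [u0|u0] := leP 0 u.
  have le1 := expR_sub1_le u.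
  have le2 : u * (expR u - 1) <= u * (u * expR u) by rewrite ler_wpM2l.
  have : 0 <= u ^+ 2 * expR (- u) by rewrite mulr_ge0 ?sqr_ge0 ?expR_ge0.
  nra.
have le1 := expR_sub1_le u.
have le2 : 1 - expR u <= - u by have := expR_ge1Dx u; lra.
have le3 : expR u - 1 - u <= u * (expR u - 1) by lra.
have le4 : u * (expR u - 1) <= u ^+ 2 by nra.
have le5 : 1 <= expR (- u) by rewrite -expR0 ler_expR oppr_ge0 ltW.
have : 0 <= u ^+ 2 * expR u by rewrite mulr_ge0 ?sqr_ge0 ?expR_ge0.
have : 0 <= u ^+ 2 * (expR (- u) - 1) by rewrite mulr_ge0 ?sqr_ge0 ?subr_ge0.
nra.
Qed.

(** The factor [u ^+ 2] is absorbed into exponentials, so that after integration the remainder is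
    controlled, uniformly in [t], by the generating function at [2] and [- 2]. *)
Lemma expR_le_quad t u : `|t| <= 1 ->
  expR (t * u) <= 1 + t * u + t ^+ 2 * (8 * (expR (2 * u) + expR (- 2 * u))).
Proof.
move=> t1; apply: le_trans (expR_le_taylor1 _) _.
rewrite lerD2l exprMn -mulrA ler_wpM2l ?sqr_ge0 //.
have cosh_le (v : R) : `|v| <= `|u| -> expR v <= expR `|u|.
  by move=> le; rewrite ler_expR (le_trans (ler_norm _)).
have tu : `|t * u| <= `|u| by rewrite normrM ler_piMl.
have le1 : expR (t * u) + expR (- (t * u)) <= 2 * expR `|u|.
  by rewrite mulr_natl mulr2n lerD // cosh_le // normrN.
have le2 : u ^+ 2 <= 4 * expR `|u|.
  have : `|u| / 2 <= expR (`|u| / 2).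
    by apply: le_trans (expR_ge1Dx _); rewrite lerDr.
  rewrite -[u ^+ 2]real_normK ?num_real //.
  have -> : expR `|u| = expR (`|u| / 2) ^+ 2.
    by rewrite -expRM_natl; congr expR; field.
  have := normr_ge0 u; nra.
have le3 : expR `|u| * expR `|u| <= expR (2 * u) + expR (- 2 * u).
  rewrite -expRD (_ : `|u| + `|u| = 2 * `|u|); last by ring.
  have e0 := expR_ge0 (2 * u); have e1 := expR_ge0 (- 2 * u).
  by case: (ger0P u) => u0; rewrite ?mulrN -?mulNr ?lerDl ?lerDr.
apply: (@le_trans _ _ (4 * expR `|u| * (2 * expR `|u|))).
  by rewrite ler_pM ?sqr_ge0 ?addr_ge0 ?expR_ge0.
by rewrite mulrACA; nra.
Qed.

(** Bernoulli's inequality for [expR w] raised to the real power [t]. *)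
Lemma expR_bernoulli t w : 1 <= t -> 1 + t * (expR w - 1) <= expR (t * w).
Proof.
move=> t1.
have -> : t * w = w + (t - 1) * w by ring.
rewrite expRD; apply: (@le_trans _ _ (expR w * (1 + (t - 1) * w))); last first.
  by rewrite ler_wpM2l ?expR_ge0 // expR_ge1Dx.
have := expR_sub1_le w; nra.
Qed.

End ExpInequalities.

Section Mgf.
Context d (T : measurableType d) (R : realType) (P : probability T R).
Variable X : T -> R.
Hypothesis iX : P.-integrable setT (EFin \o X).
Hypothesis X0 : \int[P]_x X x = 0.
Hypothesis iM : forall t, P.-integrable setT (EFin \o (fun x => expR (t * X x))).
Local Notation M t := (\int[P]_x expR (t * X x)).

Let iC (c : R) : P.-integrable setT (EFin \o (fun _ : T => c)).
Proof. exact: finite_measure_integrable_cst. Qed.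

Let eC (c : R) : \int[P]_x c = c.
Proof. by rewrite Rintegral_cst //= probability_setT mulr1. Qed.

Let iL (c t : R) : P.-integrable setT (EFin \o (fun x => c + t * X x)).
Proof. by apply: integrable_addR => //; exact: integrable_scaleR. Qed.

Let eL (c t : R) : \int[P]_x (c + t * X x) = c.
Proof.
rewrite RintegralD //; last exact: integrable_scaleR.
by rewrite RintegralZl // X0 mulr0 addr0 eC.
Qed.

(** Jensen's inequality for a centred variable, by integrating [1 + u <= expR u]. *)
Lemma mgf_ge1 t : 1 <= M t.
Proof.
rewrite -(eL 1 t); apply: le_Rintegral => // x _.
exact: expR_ge1Dx.
Qed.

Lemma mgf_le_quad : exists2 C : R, 0 <= C &
  forall t, `|t| <= 1 -> M t <= 1 + C * t ^+ 2.
Proof.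
exists (8 * (M 2 + M (- 2))).
  by rewrite mulr_ge0 // addr_ge0 // (le_trans ler01) ?mgf_ge1.
move=> t t1.
have i2 : P.-integrable setT
    (EFin \o (fun x => expR (2 * X x) + expR (- 2 * X x))).
  exact: integrable_addR.
have -> : 1 + 8 * (M 2 + M (- 2)) * t ^+ 2 = \int[P]_x (1 + t * X x +
    t ^+ 2 * 8 * (expR (2 * X x) + expR (- 2 * X x))).
  rewrite RintegralD //; last exact: integrable_scaleR.
  by rewrite eL RintegralZl // RintegralD //; ring.
apply: le_Rintegral => //.
  by apply: integrable_addR => //; exact: integrable_scaleR.
by move=> x _; rewrite -mulrA; exact: expR_le_quad.
Qed.

(* Bernoulli's inequality for e^(s X) / M s raised to the power t / s. *)
Lemma mgf_log_slope s t : 0 < s -> s <= t -> ln (M s) / s <= ln (M t) / t.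
Proof.
move=> s0 st; have t0 := lt_le_trans s0 st.
have Ms0 : 0 < M s := lt_le_trans ltr01 (mgf_ge1 s).
have Mt0 : 0 < M t := lt_le_trans ltr01 (mgf_ge1 t).
pose u := t / s; have u1 : 1 <= u by rewrite ler_pdivlMr // mul1r.
(* Bernoulli's inequality at [w = s * X x - ln (M s)] with power [u]; the left side has mean 1. *)
have ptw x : 1 - u + u / M s * expR (s * X x) <=
    expR (- (u * ln (M s))) * expR (t * X x).
  have := expR_bernoulli (s * X x - ln (M s)) u1.
  have -> : expR (s * X x - ln (M s)) = expR (s * X x) / M s.
    by rewrite expRD expRN lnK ?posrE.
  rewrite -expRD.
  have -> : - (u * ln (M s)) + t * X x = u * (s * X x - ln (M s)).
    by rewrite /u; field; rewrite gt_eqF.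
  by apply: le_trans; rewrite mulrBr mulr1 mulrA mulrAC addrA addrAC.
have int : 1 <= expR (- (u * ln (M s))) * M t.
  have -> : 1 = \int[P]_x (1 - u + u / M s * expR (s * X x)).
    rewrite RintegralD //; last exact: integrable_scaleR.
    by rewrite RintegralZl // eC divfK ?gt_eqF // subrK.
  rewrite -RintegralZl //; apply: le_Rintegral => //.
  - by apply: integrable_addR => //; exact: integrable_scaleR.
  - exact: integrable_scaleR.
have : u * ln (M s) <= ln (M t).
  rewrite -ler_expR lnK ?posrE //.
  have := ler_wpM2l (expR_ge0 (u * ln (M s))) int.
  by rewrite mulr1 mulrA -expRD subrr expR0 mul1r.
by rewrite ler_pdivlMr // (_ : _ / s * t = u * ln (M s)) // /u; ring.
Qed.

(** Since [expR u = 1 + u] only at [u = 0], [M s = 1] would make a nonnegative gap integrate to 0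
    and force [X] to vanish almost everywhere. *)
Lemma mgf_gt1 s : s != 0 -> ~ {ae P, forall x, X x = 0} -> 1 < M s.
Proof.
move=> s0 nae; rewrite lt_neqAle mgf_ge1 andbT; apply/eqP => M1; apply: nae.
pose f x := expR (s * X x) + (- 1 + (- s) * X x).
have fi : P.-integrable setT (EFin \o f) by apply: integrable_addR.
have f0 x : 0 <= f x.
  by rewrite /f; have := expR_ge1Dx (s * X x); lra.
have fE : \int[P]_x f x = 0 by rewrite /f RintegralD // eL -M1 subrr.
have : ae_eq P setT (EFin \o f) (cst 0%E).
  apply/ae_eq_integral_abs => //; first exact: measurable_int fi.
  under eq_integral => x _ do rewrite /= ger0_norm //.
  rewrite -[LHS]fineK ?integrable_fin_num //.
  by move: fE; rewrite /Rintegral /= => ->.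
apply: filterS => x /(_ I) /= [fx].
have : s * X x = 0.
  apply/eqP; apply: contraTT isT => sX; move: fx; rewrite /f => /eqP.
  by rewrite gt_eqF //; have := expR_gt1Dx sX; lra.
by move/eqP; rewrite mulf_eq0 (negbTE s0) => /eqP.
Qed.

(* The mean being zero, [log M] is quadratic near 0, so [N] factors at the
   scale [1 / (N tau)] contribute only [O(1 / (N tau ^ 2))]. *)
Lemma mgf_power_near1 (N : R -> nat) :
  (forall K : R, \forall t \near 0^'+, K <= (N t)%:R * t ^+ 2) ->
  forall eta : R, 0 < eta -> \forall t \near 0^'+,
    forall s, `|s| = ((N t)%:R * t)^-1 -> M s ^+ N t <= 1 + eta.
Proof.
move=> NK eta eta0; have [C C0 quad] := mgf_le_quad.
have l0 : 0 < ln (1 + eta) by rewrite ln_gt0 // ltrDl.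
near=> t => s sE.
have t0 : 0 < t by near: t; exact: nbhs_right_gt.
have t1 : t <= 1 by near: t; exact: nbhs_right_le.
have N1 : 1 <= (N t)%:R * t ^+ 2 by near: t; exact: NK.
(* This threshold brings the total exponent [C / ((N t)%:R * t ^+ 2)] below [ln (1 + eta)]. *)
have NC : C / ln (1 + eta) <= (N t)%:R * t ^+ 2 by near: t; exact: NK.
have n0 : 0 < (N t)%:R :> R.
  by have := lt_le_trans ltr01 N1; rewrite pmulr_lgt0 // exprn_gt0.
have s1 : `|s| <= 1.
  rewrite sE invf_le1 ?mulr_gt0 //; apply: le_trans N1 _.
  by rewrite ler_pM2l // expr2 ler_piMl // ltW.
have Ms : M s <= expR (C * s ^+ 2) by apply: le_trans (quad s s1) (expR_ge1Dx _).
apply: (@le_trans _ _ (expR (C * s ^+ 2) ^+ N t)).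
  by rewrite lerXn2r ?nnegrE ?expR_ge0 // (le_trans ler01) ?mgf_ge1.
rewrite -expRM_natl -[leRHS]lnK ?posrE ?addr_gt0 // ler_expR.
have -> : (N t)%:R * (C * s ^+ 2) = C / ((N t)%:R * t ^+ 2).
  rewrite -[s ^+ 2]real_normK ?num_real // sE.
  by field; rewrite !gt_eqF.
rewrite ler_pdivrMr ?mulr_gt0 ?exprn_gt0 //.
by rewrite mulrC -ler_pdivrMr.
Unshelve. all: by end_near. Qed.

(* As the temperature vanishes the Chernoff maximizer tends to 0 (by the slope
   bound), so the Chernoff exponent at [(1 - xi) tau] is [o(tau)]. *)
Lemma chernoff_samples (N : R -> nat) (xi : R) :
  0 < xi < 1 -> ~ {ae P, forall x, X x = 0} ->
  (forall t : R, 0 < t -> exists th : R,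
     (forall s, s * (1 - xi) * t - ln (M s) <= th * (1 - xi) * t - ln (M th)) /\
     (ln (4 / xi) + 2 / t) / ln (expR (th * (1 - xi) * t) / M th)
       <= (N t)%:R) ->
  forall K : R, \forall t \near 0^'+, K <= (N t)%:R * t ^+ 2.
Proof.
move=> /andP[xi0 xi1] nae hN K.
have [C C0 quad] := mgf_le_quad.
(* Once the Chernoff exponent is at most [del * t], the bound on [N] gives
   [(N t)%:R * t ^+ 2 >= 2 / del], which exceeds [K]. *)
pose del := (`|K| + 1)^-1.
have del0 : 0 < del by rewrite invr_gt0 ltr_wpDl.
have lam0 : 0 < ln (M del) / del by rewrite divr_gt0 // ln_gt0 // mgf_gt1 // gt_eqF.
have Mgt0 s : 0 < M s := lt_le_trans ltr01 (mgf_ge1 s).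
near=> t.
have t0 : 0 < t by near: t; exact: nbhs_right_gt.
have tlam : t < ln (M del) / del by near: t; exact: nbhs_right_lt.
have [th [opt]] := hN t t0.
rewrite [ln (expR _ / _)]ln_div ?posrE ?expR_gt0 // expRK.
rewrite -mulrA in opt *; set x := (1 - xi) * t in opt *.
have x0 : 0 < x by rewrite mulr_gt0 // subr_gt0.
have xt : x <= t by rewrite ler_piMl ?(ltW t0) // lerBlDr lerDl ltW.
set Lam := th * x - ln (M th) in opt *.
(* At the small trial point [s] the gain [s * x] beats [C * s ^+ 2], which bounds [ln (M s)]; hence
   the maximum is positive. *)
have Lam0 : 0 < Lam.
  pose s := x / (1 + C + x).
  have den0 : 0 < 1 + C + x by rewrite addr_gt0 // ltr_pwDl.
  have s0 : 0 < s by rewrite divr_gt0.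
  have s1 : `|s| <= 1.
    by rewrite gtr0_norm // ler_pdivrMr // mul1r lerDr addr_ge0.
  have Cs : C * s < x.
    rewrite /s mulrA ltr_pdivrMr // mulrC ltr_pM2l //.
    by rewrite addrAC ltrDr addr_gt0.
  apply: lt_le_trans (opt s); rewrite -mulrA -/x subr_gt0.
  apply: (@le_lt_trans _ _ (M s - 1)).
    by have := expR_ge1Dx (ln (M s)); rewrite lnK ?posrE //; lra.
  apply: (@le_lt_trans _ _ (C * s * s)); last by rewrite mulrC ltr_pM2l.
  by rewrite -mulrA -expr2 lerBlDl; exact: quad.
have lnM0 : 0 <= ln (M th) by rewrite ln_ge0 // mgf_ge1.
have th0 : 0 < th.
  rewrite ltNge; apply/negP => th0.
  have : th * x <= 0 by rewrite mulr_le0_ge0 // ltW.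
  by move: Lam0; rewrite /Lam; lra.
(* From [del] on, the slope [ln (M th) / th] exceeds [x], which would make [Lam] negative. *)
have thdel : th < del.
  rewrite ltNge; apply/negP => /(mgf_log_slope del0) slope.
  have : x < ln (M th) / th by apply: le_lt_trans xt (lt_le_trans tlam slope).
  by rewrite ltr_pdivlMr // => lt; move: Lam0; rewrite /Lam; lra.
have Lamdel : Lam <= del * t.
  apply: (@le_trans _ _ (th * x)); first by rewrite /Lam; lra.
  by rewrite ler_pM // ltW.
have ln4 : 0 <= ln (4 / xi).
  by rewrite ln_ge0 // ler_pdivlMr // mul1r; lra.
rewrite ler_pdivrMr // => hn.
have hn' : 2 / t <= (N t)%:R * (del * t).
  have le : (N t)%:R * Lam <= (N t)%:R * (del * t) by rewrite ler_wpM2l.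
  by apply: le_trans le; apply: le_trans hn; rewrite lerDr.
move: hn'; rewrite ler_pdivrMr //.
rewrite [X in _ <= X](_ : _ = ((N t)%:R * t ^+ 2) / (`|K| + 1));
  last by rewrite /del; ring.
rewrite ler_pdivlMr ?ltr_wpDl //.
have := ler_norm K; have := normr_ge0 K; lra.
Unshelve. all: by end_near. Qed.

End Mgf.

(** * Averaging over samples *)

Section TwoSample.
Variables (R : realType) (m1 m2 : probability R R) (F : R -> R).
Hypothesis mF : measurable_fun setT F.
Hypothesis F01 : forall s, 0 <= F s <= 1.
Let m : probability _ R := product_measure1 m1 m2.
Let D (z : R * R) := z.1 - z.2.
Local Notation E n := (two_sample_int m1 m2 n F).

Let mD : measurable_fun setT D.
Proof. exact: measurable_funB. Qed.

Let mshift n s : measurable_fun setT (E n) ->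
  measurable_fun setT (fun z => E n (s + D z)).
Proof.
by move=> mE; apply: measurableT_comp mE _; exact: measurable_funD.
Qed.

Let ishift n s : measurable_fun setT (E n) -> (forall s, 0 <= E n s <= 1) ->
  m.-integrable setT (EFin \o (fun z => E n (s + D z))).
Proof.
move=> mE E01; apply: measurable_bounded_integrable => //.
- by rewrite -ge0_fin_numE // fin_num_measure.
- exact: mshift.
- exists 1; split; first exact: num_real.
  move=> M M1 z _ /=; have /andP[E0 E1] := E01 (s + D z).
  by rewrite ger0_norm // (le_trans E1) // ltW.
Qed.

(** Both claims go through one induction: the bounds make the next integral finite, so [fine] loses
    nothing, and Tonelli gives measurability in the shift. *)
Lemma two_sample_int_measurable n :
  measurable_fun setT (E n) /\ forall s, 0 <= E n s <= 1.
Proof.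
elim: n => [//|n [mE E01]]; split.
  pose f (w : R * (R * R)) := (E n (w.1 + D w.2))%:E.
  have mf : measurable_fun setT f.
    apply/measurable_EFinP; apply: measurableT_comp mE _.
    by apply: measurable_funD => //; exact: measurableT_comp.
  have f0 w : (0 <= f w)%E by rewrite lee_fin; case/andP: (E01 (w.1 + D w.2)).
  have := @measurable_fun_fubini_tonelli_F _ _ _ _ R m f mf f0.
  by move=> mG; apply: measurableT_comp mG.
move=> s; have i := ishift s mE E01.
have one : \int[m]_z 1 = 1 :> R.
  by rewrite Rintegral_cst //= probability_setT mulr1.
change (0 <= \int[m]_z E n (s + D z) <= 1); apply/andP; split.
  by apply: Rintegral_ge0 => z _; case/andP: (E01 (s + D z)).
rewrite -[leRHS]one; apply: le_Rintegral => //.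
  exact: finite_measure_integrable_cst.
by move=> z _; case/andP: (E01 (s + D z)).
Qed.

Variables (al be ka : R).
Hypothesis iL : m.-integrable setT (EFin \o (fun z => expR (ka * D z))).
Let L := \int[m]_z expR (ka * D z).

(** The form [al + be * expR (ka * s)] is stable under averaging over a sample pair: the exponential
    part is multiplied by [L]. *)
Let step n s :
  m.-integrable setT
    (EFin \o (fun z => al + be * L ^+ n * expR (ka * (s + D z)))) /\
  \int[m]_z (al + be * L ^+ n * expR (ka * (s + D z))) =
    al + be * L ^+ n.+1 * expR (ka * s).
Proof.
have -> : (fun z => al + be * L ^+ n * expR (ka * (s + D z))) =
    (fun z => al + be * L ^+ n * expR (ka * s) * expR (ka * D z)).
  by apply/funext => z; rewrite mulrDr expRD mulrA.
have ic : m.-integrable setT (EFin \o (fun _ : R * R => al)).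
  exact: finite_measure_integrable_cst.
have ie : m.-integrable setT (EFin \o
    (fun z => be * L ^+ n * expR (ka * s) * expR (ka * D z))).
  exact: integrable_scaleR.
split; first exact: integrable_addR.
rewrite RintegralD // RintegralZl // Rintegral_cst //= probability_setT mulr1.
by rewrite -/L exprSr; ring.
Qed.

Lemma two_sample_int_le : (forall s, F s <= al + be * expR (ka * s)) ->
  forall n s, E n s <= al + be * L ^+ n * expR (ka * s).
Proof.
move=> le; elim=> [|n IH] s; first by rewrite mulr1.
have [mE E01] := two_sample_int_measurable n; have [i <-] := step n s.
by apply: le_Rintegral => //; exact: ishift.
Qed.

Lemma two_sample_int_ge : (forall s, al + be * expR (ka * s) <= F s) ->
  forall n s, al + be * L ^+ n * expR (ka * s) <= E n s.
Proof.
move=> le; elim=> [|n IH] s; first by rewrite mulr1.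
have [mE E01] := two_sample_int_measurable n; have [i <-] := step n s.
by apply: le_Rintegral => //; exact: ishift.
Qed.

End TwoSample.

(** * Marginals of the product law *)

Section ProductMarginals.
Context (R : realType) (m1 m2 : probability R R).
Let m : probability _ R := product_measure1 m1 m2.

Lemma integrable_comp_fst (f : R -> R) : m1.-integrable setT (EFin \o f) ->
  m.-integrable setT (EFin \o (f \o fst)) /\
  \int[m]_z f z.1 = \int[m1]_x f x.
Proof.
move=> fi; have mf : measurable_fun setT f.
  by apply/measurable_EFinP; exact: measurable_int fi.
have mF : measurable_fun setT (EFin \o (f \o (@fst R R))).
  by apply/measurable_EFinP; exact: measurableT_comp.
have i : m.-integrable setT (EFin \o (f \o fst)).
  apply: (iffRL (@integrable12ltyP _ _ _ _ R m1 m2 _ mF)) => /=.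
  under eq_integral => x _ do
    rewrite integral_cst //= probability_setT mule1.
  by case/integrableP: fi.
split=> //; rewrite /Rintegral; congr fine.
transitivity (\int[m1]_x \int[m2]_y (f x)%:E)%E.
  exact/esym/(integral12_prod_meas1 i).
by apply: eq_integral => x _; rewrite integral_cst //= probability_setT mule1.
Qed.

Lemma integrable_comp_snd (f : R -> R) : m2.-integrable setT (EFin \o f) ->
  m.-integrable setT (EFin \o (f \o snd)) /\
  \int[m]_z f z.2 = \int[m2]_x f x.
Proof.
move=> fi; have mf : measurable_fun setT f.
  by apply/measurable_EFinP; exact: measurable_int fi.
have mF : measurable_fun setT (EFin \o (f \o (@snd R R))).
  by apply/measurable_EFinP; exact: measurableT_comp.
have i : m.-integrable setT (EFin \o (f \o snd)).
  apply: (iffRL (@integrable12ltyP _ _ _ _ R m1 m2 _ mF)) => /=.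
  rewrite integral_cst //= probability_setT mule1.
  by case/integrableP: fi.
split=> //; rewrite /Rintegral; congr fine.
transitivity (\int[m1]_x \int[m2]_y (f y)%:E)%E.
  exact/esym/(integral12_prod_meas1 i).
by rewrite integral_cst //= probability_setT mule1.
Qed.

End ProductMarginals.

(** * Bounded and degenerate noise *)

Section BoundedVariable.
Context d (T : measurableType d) (R : realType) (P : probability T R).
Variable X : T -> R.
Hypothesis mX : measurable_fun setT X.

Lemma mgf_integrable_bounded (c l : R) :
  {ae P, forall x, c <= X x <= c + l} ->
  forall t, P.-integrable setT (EFin \o (fun x => expR (t * X x))).
Proof.
move=> aeX t; pose B := `|t| * (`|c| + `|c + l|).
have mE : measurable_fun setT (fun x => expR (t * X x)).
  by apply: measurableT_comp => //; exact: measurable_funM.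
apply: integrable_ge0_lty => //.
apply: (@le_lt_trans _ _ (\int[P]_x (expR B)%:E)%E); last first.
  by rewrite integral_cst //= probability_setT mule1 ltry.
apply: ae_ge0_le_integral => //; first exact/measurable_EFinP.
apply: filterS aeX => x /andP[cX Xl] _; rewrite lee_fin ler_expR.
apply: le_trans (ler_norm _) _; rewrite normrM ler_wpM2l //.
rewrite ler_norml; have := ler_norm (- c); have := ler_norm (c + l).
rewrite normrN; have := normr_ge0 c; have := normr_ge0 (c + l).
by move=> ? ? ? ?; apply/andP; split; lra.
Qed.

(** Serves noise confined to an interval of length 0. *)
Lemma ae_cst_mean0 (c : R) : P.-integrable setT (EFin \o X) ->
  \int[P]_x X x = 0 -> {ae P, forall x, X x = c} ->
  {ae P, forall x, X x = 0}.
Proof.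
move=> iX X0 aeX; suff c0 : c = 0 by rewrite c0 in aeX.
have <- : \int[P]_x c = c :> R.
  by rewrite Rintegral_cst //= probability_setT mulr1.
rewrite -X0 /Rintegral; congr fine; apply: ae_eq_integral => //.
  by case/integrableP: iX.
by apply: filterS aeX => x <- _.
Qed.

Lemma mgf_ae0 t : {ae P, forall x, X x = 0} -> \int[P]_x expR (t * X x) = 1.
Proof.
move=> aeX; transitivity (\int[P]_x 1 : R); last first.
  by rewrite Rintegral_cst //= probability_setT mulr1.
rewrite /Rintegral; congr fine; apply: ae_eq_integral => //.
  apply/measurable_EFinP; apply: measurableT_comp => //.
  exact: measurable_funM.
by apply: filterS aeX => x /= -> _; rewrite mulr0 expR0.
Qed.

End BoundedVariable.

(** The term [2 / t] of the bound makes [(N t)%:R * t ^+ 2] at least [c / t], which exceeds [K] for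
    small [t]. *)
Lemma hoeffding_samples (R : realType) (N : R -> nat) (xi ell : R) :
  0 < xi < 1 -> 0 < ell ->
  (forall t : R, 0 < t ->
    (ln (4 / xi) + 2 / t) * ell ^+ 2 / (2 * (1 - xi) ^+ 2 * t ^+ 2)
      <= (N t)%:R) ->
  forall K : R, \forall t \near 0^'+, K <= (N t)%:R * t ^+ 2.
Proof.
move=> /andP[xi0 xi1] l0 hN K.
pose c := ell ^+ 2 / (1 - xi) ^+ 2.
have x0 : 0 < 1 - xi by rewrite subr_gt0.
have c0 : 0 < c by rewrite divr_gt0 ?exprn_gt0.
have K0 : 0 < `|K| + 1 by rewrite ltr_wpDl.
near=> t.
have t0 : 0 < t by near: t; exact: nbhs_right_gt.
have tc : t < c / (`|K| + 1).
  by near: t; apply: nbhs_right_lt; exact: divr_gt0.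
have := hN t t0.
rewrite ler_pdivrMr ?mulr_gt0 ?exprn_gt0 // => le.
have ln4 : 0 <= ln (4 / xi).
  by rewrite ln_ge0 // ler_pdivlMr // mul1r; lra.
have le2 : 2 / t * ell ^+ 2 <= (N t)%:R * (2 * (1 - xi) ^+ 2 * t ^+ 2).
  by apply: le_trans le; rewrite ler_wpM2r ?sqr_ge0 // lerDr.
have le3 : c / t <= (N t)%:R * t ^+ 2.
  rewrite /c mulrAC ler_pdivrMr ?exprn_gt0 //.
  rewrite -(ler_pM2l (ltr0Sn R 1)); move: le2.
  by congr (_ <= _); ring.
apply: le_trans le3; rewrite ler_pdivlMr //.
move: tc; rewrite ltr_pdivlMr // => tc.
have := ler_norm K; nra.
Unshelve. all: by end_near. Qed.

(** * The logistic function under averaged noise *)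

Section SwitchBounds.
Variable R : realType.
Implicit Types y w : R.

(* Since [s * expR y = 1 - s], the logistic value at [y + w] is [s] divided by
   the mean of [1] and [expR w] with weights [s] and [1 - s]: the upper bound is
   convexity of the inverse, the lower one its tangent line at [1]. *)
Lemma logistic_le y w : let s := (1 + expR y)^-1 in
  (1 + expR (y + w))^-1 <= s * (s + s * expR y * expR (- w)).
Proof.
rewrite expRD expRN /=; have := expR_gt0 y; have := expR_gt0 w.
move: (expR y) (expR w) => e v v0 e0.
have d0 : 0 < 1 + e * v by rewrite addr_gt0 ?mulr_gt0.
have d1 : 0 < 1 + e by rewrite addr_gt0.
rewrite -subr_ge0.
have -> : (1 + e)^-1 * ((1 + e)^-1 + (1 + e)^-1 * e * v^-1) - (1 + e * v)^-1 =
   e * (v - 1) ^+ 2 / ((1 + e) ^+ 2 * v * (1 + e * v)).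
  by field; rewrite !gt_eqF.
apply: divr_ge0; first by rewrite mulr_ge0 ?sqr_ge0 // ltW.
by rewrite ltW // !mulr_gt0 ?exprn_gt0.
Qed.

Lemma logistic_ge y w : let s := (1 + expR y)^-1 in
  s * (2 - s - s * expR y * expR w) <= (1 + expR (y + w))^-1.
Proof.
rewrite expRD /=; have := expR_gt0 y; have := expR_gt0 w.
move: (expR y) (expR w) => e v v0 e0.
have d0 : 0 < 1 + e * v by rewrite addr_gt0 ?mulr_gt0.
have d1 : 0 < 1 + e by rewrite addr_gt0.
rewrite -subr_ge0.
have -> : (1 + e * v)^-1 - (1 + e)^-1 * (2 - (1 + e)^-1 - (1 + e)^-1 * e * v) =
   (e * (v - 1)) ^+ 2 / ((1 + e) ^+ 2 * (1 + e * v)).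
  by field; rewrite !gt_eqF.
by rewrite divr_ge0 ?sqr_ge0 // ltW // mulr_gt0 ?exprn_gt0.
Qed.

End SwitchBounds.

Section TwoSampleLogistic.
Variables (R : realType) (m1 m2 : probability R R) (n : nat) (tau D eta : R).
Let m : probability _ R := product_measure1 m1 m2.
Let X (z : R * R) := z.1 - z.2 - D.
(** The exponent per sample at which [n] factors multiply to the exponential of the averaged noise
    divided by [tau]. *)
Let th := (n%:R * tau)^-1.
Hypotheses (n0 : (0 < n)%N) (tau0 : 0 < tau) (eta0 : 0 <= eta).
Hypothesis iM : forall t, m.-integrable setT (EFin \o (fun z => expR (t * X z))).
Hypothesis M_near1 : forall t, `|t| = th ->
  (\int[m]_z expR (t * X z)) ^+ n <= 1 + eta.
Let F (s : R) := (1 + expR ((s / n%:R) / tau))^-1.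
Let y := D / tau.
Let s0 := (1 + expR y)^-1.

Let F01 s : 0 <= F s <= 1.
Proof.
have d1 : 0 < 1 + expR (s / n%:R / tau) by rewrite addr_gt0 ?expR_gt0.
by rewrite /F invr_ge0 ltW //= invf_le1 // lerDl expR_ge0.
Qed.

Let mF : measurable_fun setT F.
Proof.
apply: nonincreasing_measurable => // s s' ss.
rewrite /F lef_pV2 ?posrE ?addr_gt0 ?expR_gt0 // lerD2l ler_expR.
by rewrite !ler_pM2r ?invr_gt0 ?ltr0n.
Qed.

Let shift t z : expR (t * (z.1 - z.2)) = expR (t * D) * expR (t * X z).
Proof. by rewrite -expRD -mulrDr /X [D + _]addrC subrK. Qed.

Let iL t : m.-integrable setT (EFin \o (fun z => expR (t * (z.1 - z.2)))).
Proof.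
rewrite (_ : (fun z => _) = (fun z => expR (t * D) * expR (t * X z))).
  exact: integrable_scaleR.
by apply/funext => z; exact: shift.
Qed.

Let L_pow t : (\int[m]_z expR (t * (z.1 - z.2))) ^+ n =
  expR (n%:R * (t * D)) * (\int[m]_z expR (t * X z)) ^+ n.
Proof.
under eq_Rintegral => z _ do rewrite shift.
by rewrite RintegralZl // exprMn -expRM_natl.
Qed.

Let nR : n%:R != 0 :> R. Proof. by rewrite pnatr_eq0 -lt0n. Qed.
Let th0 : 0 <= th. Proof. by rewrite invr_ge0 mulr_ge0 // ltW. Qed.
Let nthD : n%:R * (th * D) = y.
Proof. by rewrite /th /y; field; rewrite nR gt_eqF. Qed.

Let s00 : 0 < s0. Proof. by rewrite invr_gt0 addr_gt0 ?expR_gt0. Qed.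
Let qE : s0 * expR y = 1 - s0.
Proof.
by rewrite /s0; field; rewrite gt_eqF // addr_gt0 ?expR_gt0.
Qed.
Let q01 : 0 <= 1 - s0 <= 1.
Proof.
apply/andP; split; last by rewrite gerBl ltW.
by rewrite -qE mulr_ge0 ?expR_ge0 // ltW.
Qed.

Lemma two_sample_logistic_le : two_sample_int m1 m2 n F 0 <= s0 * (1 + eta).
Proof.
have le s : F s <= s0 * s0 + s0 * (1 - s0) * expR y * expR (- th * s).
  have /= := logistic_le y (s * th - y); rewrite [y + _]addrC subrK.
  rewrite -/s0 qE [in leLHS](_ : s * th = s / n%:R / tau); last first.
    by rewrite /th invfM mulrA.
  move=> /le_trans; apply; rewrite mulrDr opprB expRD !mulrA.
  by rewrite mulNr [s * th]mulrC.
apply: le_trans (two_sample_int_le mF F01 (iL (- th)) le n 0) _.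
(* The mean difference contributes [expR (- y)], cancelling the [expR y] of the majorant; what
   remains is [s0] times the average of 1 and the noise moment, with weights [s0] and [1 - s0]. *)
rewrite mulr0 expR0 mulr1 L_pow mulNr mulrN nthD.
have := M_near1 (t := - th); rewrite normrN ger0_norm // => /(_ erefl) Mle.
rewrite [X in _ + X](_ : _ = s0 * (1 - s0) * (\int[m]_z expR (- th * X z)) ^+ n);
  last first.
  by rewrite mulrA -[_ * expR y * _]mulrA -expRD subrr expR0 mulr1.
case/andP: q01 => q0 q1.
rewrite -mulrA -mulrDr ler_pM2l //.
have := ler_wpM2l q0 Mle; have : (1 - s0) * eta <= eta by rewrite ler_piMl.
lra.
Qed.

Lemma two_sample_logistic_ge : s0 * (1 - eta) <= two_sample_int m1 m2 n F 0.
Proof.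
have ge s : s0 * (2 - s0) + (- (s0 * (1 - s0) * expR (- y))) * expR (th * s)
    <= F s.
  have /= := logistic_ge y (s * th - y); rewrite [y + _]addrC subrK.
  rewrite -/s0 qE [in leRHS](_ : s * th = s / n%:R / tau); last first.
    by rewrite /th invfM mulrA.
  apply: le_trans; rewrite mulrC expRD [th * s]mulrC le_eqVlt.
  by apply/orP; left; apply/eqP; ring.
apply: le_trans (two_sample_int_ge mF F01 (iL th) ge n 0).
rewrite mulr0 expR0 mulr1 L_pow nthD.
have := M_near1 (t := th); rewrite ger0_norm // => /(_ erefl) Mle.
rewrite [X in _ <= _ + X](_ : _ = - (s0 * (1 - s0) * (\int[m]_z expR (th * X z)) ^+ n));
  last first.
  by rewrite mulNr mulrA -[_ * expR (- y) * _]mulrA -expRD addNr expR0 mulr1.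
case/andP: q01 => q0 q1.
rewrite -mulrA -mulrBr ler_pM2l //.
have := ler_wpM2l q0 Mle; have : (1 - s0) * eta <= eta by rewrite ler_piMl.
lra.
Qed.

End TwoSampleLogistic.

(** * Estimation noise and switching probabilities *)

Section NoiseLaw.
Variables (R : realType) (I : finType) (A : I -> finType).
Variables (mu : I -> profile A -> probability R R) (U : I -> profile A -> R).
Variables (i : I) (a b : profile A).
Let m : probability _ R := product_measure1 (mu i a) (mu i b).
Local Notation X := (noise U i a b).

Lemma noise_measurable : measurable_fun setT X.
Proof. by apply: measurable_funB => //; exact: measurable_funB. Qed.

Hypothesis means : sample_means mu U.

Lemma noise_integrable_mean0 :
  m.-integrable setT (EFin \o X) /\ \int[m]_z X z = 0.
Proof.
have mean c : \int[mu i c]_x x = U i c by rewrite /Rintegral (means i c).2.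
have [i1 e1] := integrable_comp_fst (mu i b) (means i a).1.
have [i2 e2] := integrable_comp_snd (mu i a) (means i b).1.
rewrite mean in e1; rewrite mean in e2.
have i2' : m.-integrable setT (EFin \o (fun z => - 1 * z.2)).
  exact: integrable_scaleR.
have i12 : m.-integrable setT (EFin \o (fun z => z.1 + - 1 * z.2)).
  exact: integrable_addR.
have ic : m.-integrable setT (EFin \o (fun _ => - (U i a - U i b))).
  exact: finite_measure_integrable_cst.
have XE : X = (fun z => (z.1 + - 1 * z.2) + - (U i a - U i b)).
  by apply/funext => z; rewrite /noise mulN1r.
rewrite XE; split; first exact: integrable_addR.
rewrite RintegralD // RintegralD // RintegralZl // e1 e2.
rewrite Rintegral_cst //= probability_setT mulr1; ring.
Qed.

Lemma noise_mgf_integrable t : (noise_mgf mu U i a b t < +oo)%E ->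
  m.-integrable setT (EFin \o (fun z => expR (t * X z))).
Proof.
apply: integrable_ge0_lty => //.
by apply: measurableT_comp => //; apply: measurable_funM => //;
  exact: noise_measurable.
Qed.

End NoiseLaw.

Section Switching.
Variables (R : realType) (I : finType) (A : I -> finType).
Variables (mu : I -> profile A -> probability R R) (U : I -> profile A -> R).
Variables (N : R -> nat) (xi : R).
Hypothesis means : sample_means mu U.
Hypothesis xi01 : 0 < xi < 1.

(** Under either condition, [(N t)%:R * t ^+ 2] tends to infinity or the noise vanishes almost
    everywhere. *)
Lemma noise_mgf_near1 (i : I) (a : profile A) (x : A i) :
  cond_bounded mu U N xi \/ cond_unbounded mu U N xi -> x != a i ->
  let m := product_measure1 (mu i a) (mu i (upd a i x)) in
  let X := noise U i a (upd a i x) in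
  (forall t, m.-integrable setT (EFin \o (fun z => expR (t * X z)))) /\
  (forall eta : R, 0 < eta -> \forall t \near 0^'+,
     forall s, `|s| = ((N t)%:R * t)^-1 ->
       (\int[m]_z expR (s * X z)) ^+ N t <= 1 + eta).
Proof.
move=> cond xa m X.
have mX : measurable_fun setT X by exact: noise_measurable.
have [iX X0] := noise_integrable_mean0 i a (upd a i x) means.
have [[ell [ell0 [bd hN]]]|] := cond.
  have [c aeX] := bd i a x xa.
  have iM := mgf_integrable_bounded mX aeX.
  split=> // eta eta0.
  (* For [ell = 0] the bound on [N] is vacuous, but the noise is a.e. zero. *)
  have [ellz|elln] := eqVneq ell 0; last first.
    apply: (mgf_power_near1 iX X0 iM) => //.
    by apply: (hoeffding_samples xi01 _ hN); rewrite lt_neqAle eq_sym elln.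
  have ae0 : {ae m, forall z, X z = 0}.
    apply: (ae_cst_mean0 (c := c) iX X0).
    by apply: filterS aeX => z; rewrite ellz addr0 => /le_anti.
  near=> t => s _.
  by rewrite (mgf_ae0 mX s ae0) expr1n lerDl ltW.
move=> /(_ i a x xa)[_ _ nb fin hN].
have iM t := noise_mgf_integrable (fin t).
split=> // eta eta0; apply: (mgf_power_near1 iX X0 iM) => //.
apply: (chernoff_samples iX X0 iM xi01 _ hN) => ae0.
(* Unbounded noise cannot vanish almost everywhere. *)
by apply: nb; exists 0; apply: filterS ae0 => z ->; rewrite normr0.
Unshelve. all: by end_near. Qed.

Variable phi : profile A -> R.
Hypothesis pot : exact_potential U phi.
Hypothesis Npos : forall tau : R, 0 < tau -> (0 < N tau)%N.

Lemma switch_prob_near_logistic (i : I) (a : profile A) (x : A i) :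
  cond_bounded mu U N xi \/ cond_unbounded mu U N xi -> x != a i ->
  forall d : R, 0 < d -> \forall tau \near 0^'+,
    let s := (1 + expR ((phi a - phi (upd a i x)) / tau))^-1 in
    let sp := switch_prob mu tau (N tau) i a x in
    sp <= expR d * s /\ s <= expR d * sp.
Proof.
move=> cond xa d d0; have [iM near1] := noise_mgf_near1 cond xa.
have ed1 : 1 < expR d by rewrite expR_gt1.
have ed0 : 0 < expR d := expR_gt0 d.
have eVd : expR d * expR (- d) = 1 by rewrite -expRD subrr expR0.
(* For [eta = 1 - expR (- d)], [1 - eta] is exactly [expR (- d)], and [1 + eta <= expR d] because
   [expR d + expR (- d) >= 2]. *)
have eta0 : 0 < 1 - expR (- d) by rewrite subr_gt0 expR_lt1 oppr_lt0.
near=> t; have t0 : 0 < t by near: t; exact: nbhs_right_gt.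
have M1 : forall s, `|s| = ((N t)%:R * t)^-1 ->
    (\int[product_measure1 (mu i a) (mu i (upd a i x))]_z
       expR (s * noise U i a (upd a i x) z)) ^+ N t <= 1 + (1 - expR (- d)).
  by near: t; exact: near1 eta0.
(* The exact potential turns the potential difference into the utility difference, the mean of the
   sampled one. *)
rewrite /= -pot.
have s0 : 0 <= (1 + expR ((U i a - U i (upd a i x)) / t))^-1.
  by rewrite invr_ge0 addr_ge0 ?expR_ge0.
have le := two_sample_logistic_le (Npos t0) t0 (ltW eta0) iM M1.
have ge := two_sample_logistic_ge (Npos t0) t0 (ltW eta0) iM M1.
rewrite /switch_prob; split.
  apply: le_trans le _; rewrite mulrC ler_wpM2r //.
  by have := expR_ge1Dx d; have := expR_gt0 (- d); nra.
have := ler_wpM2l (ltW ed0) ge.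
by rewrite opprB [1 + (_ - _)]addrC subrK mulrCA eVd mulr1.
Unshelve. all: by end_near. Qed.

End Switching.

Unset Implicit Arguments.

Theorem theorem1 (R : realType) (I : finType) (A : I -> finType)
  (mu : I -> profile A -> probability R R)
  (U : I -> profile A -> R) (phi : profile A -> R)
  (N : R -> nat) (pi : R -> profile A -> R) :
  sample_means mu U ->
  exact_potential U phi ->
  normalized_potential phi ->
  (forall tau : R, 0 < tau -> (0 < N tau)%N) ->
  (forall tau : R, 0 < tau ->
     stationary (blla_trans mu tau (N tau)) (pi tau)) ->
  (exists xi : R, 0 < xi < 1 /\
     (cond_bounded mu U N xi \/ cond_unbounded mu U N xi)) ->
  forall a : profile A,
    stochastically_stable pi a <-> (forall b : profile A, phi b <= phi a).
Proof.
move=> means pot _ Npos st [xi [xi01 cond]].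
apply: (stable_iff_max st) => d d0.
(* Finiteness of players, profiles and actions yields one neighbourhood valid for all switches. *)
apply: filter_forall => i; apply: filter_forall => a; apply: filter_forall => x.
have [->|xa] := eqVneq x (a i).
  by near=> t.
have := switch_prob_near_logistic means xi01 pot Npos cond xa d0.
by apply: filterS.
Unshelve. all: by end_near. Qed.
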